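(* The following is provable in $\mathsf{RCA}_0$: every proper 1-1 interval order is a proper closed interval order.
   Context: $\mathsf{RCA}_0$ is the base subsystem of second-order arithmetic ($\Delta^0_1$ comprehension, $\Sigma^0_1$ induction). A partial order $\mathbf{P}=(P,\leq_P)$ is a set $P\subseteq\mathbb{N}$ with a reflexive, transitive, antisymmetric relation; a linear order has any two elements comparable; $p<_P q$ means $p\leq_P q$, $p\ne q$. $\mathbf{P}$ is a proper 1-1 interval order if there are a linear order $\mathbf{L}=(L,\leq_L)$ and $F\subseteq P\times L$ such that, with $F(p)=\{x:(p,x)\in F\}$: (i1) each $F(p)$ is nonempty and convex ($x,y\in F(p)$, $x<_L z<_L y$ imply $z\in F(p)$); (i2) $p<_P q$ iff $x<_L y$ for all $x\in F(p),y\in F(q)$; (i3) $F(p)\ne F(q)$ whenever $p\ne q$; (i4) $F(p)\subseteq F(q)$ implies $F(p)=F(q)$. $\mathbf{P}$ is a proper closed interval order if there are a linear order $\mathbf{L}$ and $f_0,f_1:P\to L$ with (c1) $f_0(p)\leq_L f_1(p)$ for all $p$; (c2) $p<_P q$ iff $f_1(p)<_L f_0(q)$; (c5) $f_0(p)<_L f_0(q)$ iff $f_1(p)<_L f_1(q)$ for all $p,q$. *)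

(* Defs.v *)
From Stdlib Require Import List.
Import ListNotations.

(** * The language of second-order arithmetic

    Number variables and set variables are de Bruijn indices in two separate
    name spaces.  There is no equality symbol between sets. *)

Inductive term : Type :=
| Var (n : nat)
| Zero
| One
| Plus (s t : term)
| Times (s t : term).

Inductive form : Type :=
| Equal (s t : term)
| Less (s t : term)
| Mem (t : term) (X : nat)
| Bot
| Imp (a b : form)
| All1 (a : form)  (* binds number variable 0 *)
| All2 (a : form). (* binds set variable 0 *)

Definition Neg (a : form) : form := Imp a Bot.
Definition And (a b : form) : form := Neg (Imp a (Neg b)).
Definition Or (a b : form) : form := Imp (Neg a) b.
Definition Iff (a b : form) : form := And (Imp a b) (Imp b a).
Definition Ex1 (a : form) : form := Neg (All1 (Neg a)).
Definition Ex2 (a : form) : form := Neg (All2 (Neg a)).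

Definition scons {A : Type} (x : A) (s : nat -> A) (n : nat) : A :=
  match n with O => x | S m => s m end.

Fixpoint tsubst (s : nat -> term) (t : term) : term :=
  match t with
  | Var n => s n
  | Zero => Zero
  | One => One
  | Plus t1 t2 => Plus (tsubst s t1) (tsubst s t2)
  | Times t1 t2 => Times (tsubst s t1) (tsubst s t2)
  end.

Definition tshift (t : term) : term := tsubst (fun n => Var (S n)) t.

(** Capture-avoiding simultaneous substitution: [s] acts on the number
    variables and [r] on the set variables (the only terms of set sort). *)
Fixpoint subst (s : nat -> term) (r : nat -> nat) (a : form) : form :=
  match a with
  | Equal t1 t2 => Equal (tsubst s t1) (tsubst s t2)
  | Less t1 t2 => Less (tsubst s t1) (tsubst s t2)
  | Mem t X => Mem (tsubst s t) (r X)
  | Bot => Bot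
  | Imp b c => Imp (subst s r b) (subst s r c)
  | All1 b => All1 (subst (scons (Var 0) (fun n => tshift (s n))) r b)
  | All2 b => All2 (subst s (scons 0 (fun n => S (r n))) b)
  end.

Definition shift1 (a : form) : form := subst (fun n => Var (S n)) (fun X => X) a.
Definition shift2 (a : form) : form := subst Var S a.
Definition inst1 (t : term) (a : form) : form := subst (scons t Var) (fun X => X) a.
Definition inst2 (Y : nat) (a : form) : form := subst Var (scons Y (fun X => X)) a.

(** * Classical natural deduction with equality for two-sorted logic

    An axiom of [T] stands for its universal closure: [prv_ax] may be used under
    any context, so that [prv_all1I] and [prv_all2I] can generalise over all the
    free variables of the axiom. *)

Inductive prv (T : form -> Prop) : list form -> form -> Prop :=
| prv_ax G a : T a -> prv T G a
| prv_hyp G a : In a G -> prv T G a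
| prv_impI G a b : prv T (a :: G) b -> prv T G (Imp a b)
| prv_impE G a b : prv T G (Imp a b) -> prv T G a -> prv T G b
| prv_raa G a : prv T (Neg a :: G) Bot -> prv T G a
| prv_all1I G a : prv T (map shift1 G) a -> prv T G (All1 a)
| prv_all1E G a t : prv T G (All1 a) -> prv T G (inst1 t a)
| prv_all2I G a : prv T (map shift2 G) a -> prv T G (All2 a)
| prv_all2E G a Y : prv T G (All2 a) -> prv T G (inst2 Y a)
| prv_eq_refl G t : prv T G (Equal t t)
| prv_eq_subst G a s t :
    prv T G (Equal s t) -> prv T G (inst1 s a) -> prv T G (inst1 t a).

Definition provable (T : form -> Prop) (a : form) : Prop := prv T [] a.

(** * The axioms of [RCA0] *)

(** Formulas all of whose quantifiers are bounded number quantifiers; set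
    parameters are allowed.  The bound [t] is shifted because it may not contain
    the variable being quantified. *)
Inductive Delta00 : form -> Prop :=
| D_eq s t : Delta00 (Equal s t)
| D_lt s t : Delta00 (Less s t)
| D_mem t X : Delta00 (Mem t X)
| D_bot : Delta00 Bot
| D_imp a b : Delta00 a -> Delta00 b -> Delta00 (Imp a b)
| D_ball t a : Delta00 a -> Delta00 (All1 (Imp (Less (Var 0) (tshift t)) a))
| D_bex t a : Delta00 a -> Delta00 (Ex1 (And (Less (Var 0) (tshift t)) a)).

Definition Sigma01 (a : form) : Prop := exists b, Delta00 b /\ a = Ex1 b.
Definition Pi01 (a : form) : Prop := exists b, Delta00 b /\ a = All1 b.

Definition Succ (t : term) : term := Plus t One.

(** In both schemes number variable 0 of [a] (and [b]) is the distinguished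
    variable and all the other free variables are parameters. *)
Definition induction_axiom (a : form) : form :=
  Imp (And (inst1 Zero a)
           (All1 (Imp a (subst (scons (Succ (Var 0)) (fun n => Var (S n)))
                               (fun X => X) a))))
      (All1 a).

Definition comprehension_axiom (a b : form) : form :=
  Imp (All1 (Iff a b)) (Ex2 (All1 (Iff (Mem (Var 0) 0) (shift2 a)))).

Inductive RCA0 : form -> Prop :=
| ax_succ_neq0 : RCA0 (Neg (Equal (Succ (Var 0)) Zero))
| ax_succ_inj : RCA0 (Imp (Equal (Succ (Var 0)) (Succ (Var 1))) (Equal (Var 0) (Var 1)))
| ax_plus0 : RCA0 (Equal (Plus (Var 0) Zero) (Var 0))
| ax_plusS : RCA0 (Equal (Plus (Var 0) (Succ (Var 1))) (Succ (Plus (Var 0) (Var 1))))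
| ax_times0 : RCA0 (Equal (Times (Var 0) Zero) Zero)
| ax_timesS :
    RCA0 (Equal (Times (Var 0) (Succ (Var 1))) (Plus (Times (Var 0) (Var 1)) (Var 0)))
| ax_lt0 : RCA0 (Neg (Less (Var 0) Zero))
| ax_ltS :
    RCA0 (Iff (Less (Var 0) (Succ (Var 1)))
              (Or (Less (Var 0) (Var 1)) (Equal (Var 0) (Var 1))))
| ax_Sigma01_induction a : Sigma01 a -> RCA0 (induction_axiom a)
| ax_Delta01_comprehension a b :
    Sigma01 a -> Pi01 b -> RCA0 (comprehension_axiom a b).

(** * Writing sentences with named variables

    An expression of type [tm], [st] or [fm] is a term, set variable or formula
    parameterised by the number of enclosing binders ([d] number binders, [e] set
    binders).  The variable introduced by the binder at depth [d] has de Bruijn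
    index [d' - S d] when it occurs at depth [d']. *)

Definition tm := nat -> term.
Definition st := nat -> nat.
Definition fm := nat -> nat -> form.

Definition sentence (A : fm) : form := A 0 0.

Definition teq (x y : tm) : fm := fun d _ => Equal (x d) (y d).
Definition mem (x : tm) (X : st) : fm := fun d e => Mem (x d) (X e).
Definition neg (A : fm) : fm := fun d e => Neg (A d e).
Definition fconj (A B : fm) : fm := fun d e => And (A d e) (B d e).
Definition disj (A B : fm) : fm := fun d e => Or (A d e) (B d e).
Definition impl (A B : fm) : fm := fun d e => Imp (A d e) (B d e).
Definition equi (A B : fm) : fm := fun d e => Iff (A d e) (B d e).
Definition all1 (A : tm -> fm) : fm :=
  fun d e => All1 (A (fun d' => Var (d' - S d)) (S d) e).
Definition ex1 (A : tm -> fm) : fm :=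
  fun d e => Ex1 (A (fun d' => Var (d' - S d)) (S d) e).
Definition all2 (A : st -> fm) : fm :=
  fun d e => All2 (A (fun e' => e' - S e) d (S e)).
Definition ex2 (A : st -> fm) : fm :=
  fun d e => Ex2 (A (fun e' => e' - S e) d (S e)).

Declare Scope l2_scope.
Delimit Scope l2_scope with l2.
Bind Scope l2_scope with fm.

Notation "x ≐ y" := (teq x y) (at level 70, no associativity) : l2_scope.
Notation "x ∈ X" := (mem x X) (at level 70, no associativity) : l2_scope.
Notation "¬ A" := (neg A) (at level 75, right associativity) : l2_scope.
Notation "A ∧ B" := (fconj A B) (at level 80, right associativity) : l2_scope.
Notation "A ∨ B" := (disj A B) (at level 85, right associativity) : l2_scope.
Notation "A ⇒ B" := (impl A B) (at level 90, right associativity) : l2_scope.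
Notation "A ⇔ B" := (equi A B) (at level 95, no associativity) : l2_scope.
Notation "∀¹ x .. y , A" := (all1 (fun x => .. (all1 (fun y => A%l2)) ..))
  (at level 200, x binder, y binder, right associativity) : l2_scope.
Notation "∃¹ x .. y , A" := (ex1 (fun x => .. (ex1 (fun y => A%l2)) ..))
  (at level 200, x binder, y binder, right associativity) : l2_scope.
Notation "∀² X .. Y , A" := (all2 (fun X => .. (all2 (fun Y => A%l2)) ..))
  (at level 200, X binder, Y binder, right associativity) : l2_scope.
Notation "∃² X .. Y , A" := (ex2 (fun X => .. (ex2 (fun Y => A%l2)) ..))
  (at level 200, X binder, Y binder, right associativity) : l2_scope.

(** * Orders and interval orders in the language of second-order arithmetic *)

Local Open Scope l2_scope.

(** The pairing function $(x + y)^2 + x$; binary relations and functions are sets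
    of codes of pairs. *)
Definition code (x y : tm) : tm :=
  fun d => Plus (Times (Plus (x d) (y d)) (Plus (x d) (y d))) (x d).

Definition rel (R : st) (x y : tm) : fm := code x y ∈ R.

Definition srel (R : st) (x y : tm) : fm := rel R x y ∧ ¬ x ≐ y.

Definition subset_prod (R X Y : st) : fm :=
  ∀¹ n, n ∈ R ⇒ ∃¹ x y, x ∈ X ∧ y ∈ Y ∧ n ≐ code x y.

Definition partial_order (P leP : st) : fm :=
  subset_prod leP P P ∧
  (∀¹ p, p ∈ P ⇒ rel leP p p) ∧
  (∀¹ p q r, rel leP p q ∧ rel leP q r ⇒ rel leP p r) ∧
  (∀¹ p q, rel leP p q ∧ rel leP q p ⇒ p ≐ q).

Definition linear_order (L leL : st) : fm :=
  partial_order L leL ∧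
  (∀¹ x y, x ∈ L ∧ y ∈ L ⇒ rel leL x y ∨ rel leL y x).

Definition is_function (f X Y : st) : fm :=
  subset_prod f X Y ∧
  (∀¹ x, x ∈ X ⇒ ∃¹ y, rel f x y) ∧
  (∀¹ x y z, rel f x y ∧ rel f x z ⇒ y ≐ z).

(** [x ∈ F(p)] is [rel F p x]. *)
Definition section_sub (F : st) (p q : tm) : fm := ∀¹ x, rel F p x ⇒ rel F q x.
Definition section_eq (F : st) (p q : tm) : fm := ∀¹ x, rel F p x ⇔ rel F q x.

Definition cond_i1 (P L leL F : st) : fm :=
  ∀¹ p, p ∈ P ⇒
    (∃¹ x, rel F p x) ∧
    (∀¹ x y z, rel F p x ∧ rel F p y ∧ z ∈ L ∧ srel leL x z ∧ srel leL z y ⇒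
       rel F p z).
Definition cond_i2 (P leP leL F : st) : fm :=
  ∀¹ p q, p ∈ P ∧ q ∈ P ⇒
    (srel leP p q ⇔ (∀¹ x y, rel F p x ∧ rel F q y ⇒ srel leL x y)).
Definition cond_i3 (P F : st) : fm :=
  ∀¹ p q, p ∈ P ∧ q ∈ P ⇒ ¬ p ≐ q ⇒ ¬ section_eq F p q.
Definition cond_i4 (P F : st) : fm :=
  ∀¹ p q, p ∈ P ∧ q ∈ P ⇒ section_sub F p q ⇒ section_eq F p q.

Definition proper_11_interval_order (P leP : st) : fm :=
  partial_order P leP ∧
  (∃² L leL F,
     linear_order L leL ∧ subset_prod F P L ∧
     cond_i1 P L leL F ∧ cond_i2 P leP leL F ∧ cond_i3 P F ∧ cond_i4 P F).

(** [f(p) = x] is [rel f p x]; statements about values of [f0] and [f1] quantify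
    over these values. *)
Definition cond_c1 (P leL f0 f1 : st) : fm :=
  ∀¹ p x y, p ∈ P ∧ rel f0 p x ∧ rel f1 p y ⇒ rel leL x y.
Definition cond_c2 (P leP leL f0 f1 : st) : fm :=
  ∀¹ p q x y, p ∈ P ∧ q ∈ P ∧ rel f1 p x ∧ rel f0 q y ⇒
    (srel leP p q ⇔ srel leL x y).
Definition cond_c5 (P leL f0 f1 : st) : fm :=
  ∀¹ p q x0 y0 x1 y1,
    p ∈ P ∧ q ∈ P ∧ rel f0 p x0 ∧ rel f0 q y0 ∧ rel f1 p x1 ∧ rel f1 q y1 ⇒
    (srel leL x0 y0 ⇔ srel leL x1 y1).

Definition proper_closed_interval_order (P leP : st) : fm :=
  partial_order P leP ∧
  (∃² L leL f0 f1,
     linear_order L leL ∧ is_function f0 P L ∧ is_function f1 P L ∧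
     cond_c1 P leL f0 f1 ∧ cond_c2 P leP leL f0 f1 ∧ cond_c5 P leL f0 f1).

(* Main.v *)
(** By Henkin's completeness theorem for the calculus it suffices to argue in an
    arbitrary model of [RCA0].  There, by (i3) and (i4), distinct [p] and [q]
    have [x] in [F(p) \ F(q)] and [y] in [F(q) \ F(p)], and convexity makes the
    comparison of [x] with [y] independent of their choice.  Hence "F(p) lies
    to the left of F(q)" is a Delta^0_1 strict linear order on [P].  The new
    linear order is [P * {0,1}], a left and a right endpoint for each element:
    endpoints of the same kind are compared by this order, and the right
    endpoint of [p] precedes the left endpoint of [q] iff [p <_P q]. *)

(* The endpoints cannot simply be chosen in L, since a set F(p) may have neither a least nor a
   greatest element; hence new points. Inclusion between the F(p) is only Pi^0_1, but (i3) and (i4)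
   exclude it for distinct elements, so a search for x in F(p) \ F(q) and y in F(q) \ F(p) always
   succeeds. This gives two descriptions of the same relation: some such pair has x <= y
   (Sigma^0_1), or p and q are distinct and no such pair has y <= x (Pi^0_1). Convexity upgrades one
   pair with x <= y to a uniform fact: x lies left of all of F(q), and y lies right of all of F(p).
   Condition (c5) then costs nothing, because left and right endpoints are compared by one relation;
   the real work is transitivity when the two kinds of endpoints are mixed. Passing to models
   replaces derivations in the calculus by Rocq reasoning with Leibniz equality and [ring]. The
   models may be nonstandard, so arithmetic and pairing have to be rebuilt from the axioms. *)
Require Import Defs.
From Stdlib Require Import List PeanoNat Lia Cantor Ring.
From Stdlib Require Import Classical ClassicalEpsilon.
From Stdlib Require Import FunctionalExtensionality PropExtensionality ProofIrrelevance.
Import ListNotations.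

(** * Substitution *)

Definition up1 (s : nat -> term) : nat -> term :=
  scons (Var 0) (fun n => tshift (s n)).
Definition up2 (r : nat -> nat) : nat -> nat := scons 0 (fun n => S (r n)).

Lemma tsubst_tsubst s s' t :
  tsubst s' (tsubst s t) = tsubst (fun n => tsubst s' (s n)) t.
Proof. induction t; cbn; congruence. Qed.

Lemma tsubst_var t : tsubst Var t = t.
Proof. induction t; cbn; congruence. Qed.

Lemma tsubst_up1_tshift s t : tsubst (up1 s) (tshift t) = tshift (tsubst s t).
Proof. unfold tshift. now rewrite !tsubst_tsubst. Qed.

Lemma up1_comp s s' :
  (fun n => tsubst (up1 s') (up1 s n)) = up1 (fun n => tsubst s' (s n)).
Proof.
  apply functional_extensionality. intros [|n]; [easy|].
  apply tsubst_up1_tshift.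
Qed.

Lemma up2_comp r r' : (fun n => up2 r' (up2 r n)) = up2 (fun n => r' (r n)).
Proof. apply functional_extensionality. now intros [|n]. Qed.

Lemma up1_var : up1 Var = Var.
Proof. apply functional_extensionality. now intros [|n]. Qed.

Lemma up2_id : up2 (fun X => X) = (fun X => X).
Proof. apply functional_extensionality. now intros [|n]. Qed.

Lemma subst_subst a : forall s r s' r',
  subst s' r' (subst s r a)
  = subst (fun n => tsubst s' (s n)) (fun X => r' (r X)) a.
Proof.
  induction a; intros s0 r s' r'; cbn; rewrite ?tsubst_tsubst; f_equal; auto.
  - rewrite IHa. f_equal. apply up1_comp.
  - rewrite IHa. f_equal. apply up2_comp.
Qed.

Lemma subst_var a : subst Var (fun X => X) a = a.
Proof.
  induction a; cbn; rewrite ?tsubst_var; try congruence; f_equal.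
  - change (subst (up1 Var) (fun X => X) a = a). now rewrite up1_var.
  - change (subst Var (up2 (fun X => X)) a = a). now rewrite up2_id.
Qed.

Lemma subst_inst1 s r t a :
  subst s r (inst1 t a) = inst1 (tsubst s t) (subst (up1 s) r a).
Proof.
  unfold inst1. rewrite !subst_subst. f_equal.
  apply functional_extensionality. intros [|n]; cbn; [easy|].
  unfold tshift. rewrite tsubst_tsubst. cbn. symmetry. apply tsubst_var.
Qed.

Lemma subst_inst2 s r Y a :
  subst s r (inst2 Y a) = inst2 (r Y) (subst s (up2 r) a).
Proof.
  unfold inst2. rewrite !subst_subst. f_equal.
  - apply functional_extensionality. intros n. cbn. symmetry. apply tsubst_var.
  - apply functional_extensionality. now intros [|n].
Qed.

Lemma subst_shift1 s r a :
  subst (up1 s) r (shift1 a) = shift1 (subst s r a).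
Proof. unfold shift1. now rewrite !subst_subst. Qed.

Lemma subst_shift2 s r a :
  subst s (up2 r) (shift2 a) = shift2 (subst s r a).
Proof.
  unfold shift2. rewrite !subst_subst. f_equal.
  apply functional_extensionality. intros n. cbn. symmetry. apply tsubst_var.
Qed.

(** * Derivations *)

Lemma prv_weaken T G a : prv T G a -> forall G', incl G G' -> prv T G' a.
Proof.
  induction 1; intros G' HG.
  - now apply prv_ax.
  - apply prv_hyp. auto.
  - apply prv_impI, IHprv. intros x [->|Hx]; [now left|right; auto].
  - eapply prv_impE; eauto.
  - apply prv_raa, IHprv. intros x [->|Hx]; [now left|right; auto].
  - apply prv_all1I, IHprv. now apply incl_map.
  - apply prv_all1E; auto.
  - apply prv_all2I, IHprv. now apply incl_map.
  - apply prv_all2E; auto.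
  - apply prv_eq_refl.
  - eapply prv_eq_subst; eauto.
Qed.

(** Provability is required rather than membership in [T], because the basic axioms of [RCA0] are
    single formulas in the variables 0 and 1 and their instances are not axioms. *)
Definition subst_closed (T : form -> Prop) : Prop :=
  forall a s r, T a -> provable T (subst s r a).

Lemma prv_subst T G a : subst_closed T -> prv T G a ->
  forall s r, prv T (map (subst s r) G) (subst s r a).
Proof.
  intros HT. induction 1; intros s0 r0.
  - apply prv_weaken with []; [now apply HT | easy].
  - apply prv_hyp. now apply in_map.
  - apply prv_impI, IHprv.
  - eapply prv_impE; [apply IHprv1 | apply IHprv2].
  - apply prv_raa, IHprv.
  - cbn. apply prv_all1I. specialize (IHprv (up1 s0) r0).
    rewrite map_map in *. erewrite map_ext; [exact IHprv|].
    intros b. symmetry. apply subst_shift1.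
  - rewrite subst_inst1. apply prv_all1E, IHprv.
  - cbn. apply prv_all2I. specialize (IHprv s0 (up2 r0)).
    rewrite map_map in *. erewrite map_ext; [exact IHprv|].
    intros b. symmetry. apply subst_shift2.
  - rewrite subst_inst2. apply prv_all2E, IHprv.
  - apply prv_eq_refl.
  - rewrite subst_inst1. eapply prv_eq_subst; [apply IHprv1|].
    rewrite <- subst_inst1. apply IHprv2.
Qed.

(** Strict bounds on all the variable indices that occur; the shift of indices
    under binders is ignored. *)
Fixpoint tbound (t : term) : nat :=
  match t with
  | Var n => S n
  | Zero | One => 0
  | Plus s t | Times s t => max (tbound s) (tbound t)
  end.

Fixpoint bound1 (a : form) : nat :=
  match a with
  | Equal s t | Less s t => max (tbound s) (tbound t)
  | Mem t _ => tbound t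
  | Bot => 0
  | Imp a b => max (bound1 a) (bound1 b)
  | All1 a | All2 a => bound1 a
  end.

Fixpoint bound2 (a : form) : nat :=
  match a with
  | Mem _ X => S X
  | Imp a b => max (bound2 a) (bound2 b)
  | All1 a | All2 a => bound2 a
  | _ => 0
  end.

Lemma tsubst_bound t : forall s s',
  (forall n, n < tbound t -> s n = s' n) -> tsubst s t = tsubst s' t.
Proof.
  induction t; cbn; intros s s' H; auto;
    rewrite (IHt1 s s'), (IHt2 s s'); auto; intros; apply H; lia.
Qed.

Lemma subst_bound a : forall s r s' r',
  (forall n, n < bound1 a -> s n = s' n) ->
  (forall n, n < bound2 a -> r n = r' n) -> subst s r a = subst s' r' a.
Proof.
  induction a; cbn; intros s0 r0 s' r' H1 H2;
    try (f_equal; [apply tsubst_bound; intros; apply H1; lia..]).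
  - f_equal; [apply tsubst_bound; auto | apply H2; lia].
  - easy.
  - f_equal; [apply IHa1 | apply IHa2]; intros; first [apply H1 | apply H2]; lia.
  - f_equal. apply IHa; [|easy]. intros [|n] Hn; cbn; [easy|].
    rewrite H1; [easy|lia].
  - f_equal. apply IHa; [easy|]. intros [|n] Hn; cbn; [easy|].
    rewrite H2; [easy|lia].
Qed.

(** The rule [prv_all1I] wants a shifted context, while Henkin witnesses are fresh variables over an
    unshifted one. Renaming [k] to 0 and every other [n] to [n + 1] converts one into the other: it
    acts as a shift on formulas whose indices lie below [k]. *)
Lemma prv_gen1 T G a k : subst_closed T ->
  (forall b, In b (a :: G) -> bound1 b <= k) ->
  prv T G (inst1 (Var k) a) -> prv T G (All1 a).
Proof.
  intros HT Hk H. apply prv_all1I.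
  set (s := fun n => if n =? k then Var 0 else Var (S n)).
  apply (prv_subst _ _ _ HT) with (s := s) (r := fun X => X) in H.
  assert (Hs : forall n, n < k -> s n = Var (S n)).
  { intros n Hn. unfold s. destruct (Nat.eqb_spec n k); [lia|easy]. }
  replace (subst s (fun X => X) (inst1 (Var k) a)) with a in H.
  - erewrite map_ext_in; [exact H|]. intros b Hb. apply subst_bound; [|easy].
    intros n Hn. symmetry. apply Hs. pose proof (Hk b (or_intror Hb)). lia.
  - unfold inst1. rewrite subst_subst. rewrite <- (subst_var a) at 1.
    apply subst_bound; [|easy]. intros [|n] Hn; cbn.
    + unfold s. now rewrite Nat.eqb_refl.
    + symmetry. apply Hs. pose proof (Hk a (or_introl eq_refl)). lia.
Qed.

Lemma prv_gen2 T G a k : subst_closed T ->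
  (forall b, In b (a :: G) -> bound2 b <= k) ->
  prv T G (inst2 k a) -> prv T G (All2 a).
Proof.
  intros HT Hk H. apply prv_all2I.
  set (r := fun n => if n =? k then 0 else S n).
  apply (prv_subst _ _ _ HT) with (s := Var) (r := r) in H.
  assert (Hr : forall n, n < k -> r n = S n).
  { intros n Hn. unfold r. destruct (Nat.eqb_spec n k); [lia|easy]. }
  replace (subst Var r (inst2 k a)) with a in H.
  - erewrite map_ext_in; [exact H|]. intros b Hb. apply subst_bound; [easy|].
    intros n Hn. symmetry. apply Hr. pose proof (Hk b (or_intror Hb)). lia.
  - unfold inst2. rewrite subst_subst. rewrite <- (subst_var a) at 1.
    apply subst_bound; [easy|]. intros [|n] Hn; cbn.
    + unfold r. now rewrite Nat.eqb_refl.
    + symmetry. apply Hr. pose proof (Hk a (or_introl eq_refl)). lia.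
Qed.

(** * Models *)

Record structure : Type := {
  num : Type;
  sets : Type;
  zero : num;
  one : num;
  plus : num -> num -> num;
  times : num -> num -> num;
  lt : num -> num -> Prop;
  elem : num -> sets -> Prop
}.

Fixpoint eval (W : structure) (v : nat -> num W) (t : term) : num W :=
  match t with
  | Var n => v n
  | Zero => zero W
  | One => one W
  | Plus s t => plus W (eval W v s) (eval W v t)
  | Times s t => times W (eval W v s) (eval W v t)
  end.

Fixpoint sat (W : structure) (v : nat -> num W) (V : nat -> sets W) (a : form)
  : Prop :=
  match a with
  | Equal s t => eval W v s = eval W v t
  | Less s t => lt W (eval W v s) (eval W v t)
  | Mem t X => elem W (eval W v t) (V X)
  | Bot => False
  | Imp a b => sat W v V a -> sat W v V b
  | All1 a => forall x, sat W (scons x v) V a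
  | All2 a => forall X, sat W v (scons X V) a
  end.

Definition models (W : structure) (T : form -> Prop) : Prop :=
  forall a v V, T a -> sat W v V a.

Lemma forall_iff (A : Type) (Q R : A -> Prop) :
  (forall x, Q x <-> R x) -> (forall x, Q x) <-> (forall x, R x).
Proof. firstorder. Qed.

Lemma eval_tsubst W v s t :
  eval W v (tsubst s t) = eval W (fun n => eval W v (s n)) t.
Proof. induction t; cbn; congruence. Qed.

Lemma sat_subst W a : forall v V s r,
  sat W v V (subst s r a)
  <-> sat W (fun n => eval W v (s n)) (fun X => V (r X)) a.
Proof.
  induction a; cbn; intros v V s0 r; rewrite ?eval_tsubst; try easy.
  - now rewrite IHa1, IHa2.
  - apply forall_iff. intros x. rewrite IHa.
    replace (fun n => eval W (scons x v) (scons (Var 0) (fun m => tshift (s0 m)) n))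
      with (scons x (fun n => eval W v (s0 n))); [easy|].
    apply functional_extensionality. intros [|n]; cbn; [easy|].
    unfold tshift. now rewrite eval_tsubst.
  - apply forall_iff. intros X. rewrite IHa.
    replace (fun Y => scons X V (scons 0 (fun m => S (r m)) Y))
      with (scons X (fun Y => V (r Y))); [easy|].
    apply functional_extensionality. now intros [|n].
Qed.

(** * Completeness *)

Fixpoint tcode (t : term) : nat :=
  match t with
  | Var n => to_nat (0, n)
  | Zero => to_nat (1, 0)
  | One => to_nat (2, 0)
  | Plus s t => to_nat (3, to_nat (tcode s, tcode t))
  | Times s t => to_nat (4, to_nat (tcode s, tcode t))
  end.

Fixpoint fcode (a : form) : nat :=
  match a with
  | Equal s t => to_nat (0, to_nat (tcode s, tcode t))
  | Less s t => to_nat (1, to_nat (tcode s, tcode t))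
  | Mem t X => to_nat (2, to_nat (tcode t, X))
  | Bot => to_nat (3, 0)
  | Imp a b => to_nat (4, to_nat (fcode a, fcode b))
  | All1 a => to_nat (5, fcode a)
  | All2 a => to_nat (6, fcode a)
  end.

Ltac to_nat_inversion :=
  repeat match goal with
    | H : to_nat _ = to_nat _ |- _ =>
        apply to_nat_inj, pair_equal_spec in H as [? ?]
    end; try discriminate.

Lemma tcode_inj s t : tcode s = tcode t -> s = t.
Proof.
  revert t. induction s; intros [] H; cbn -[to_nat] in H; to_nat_inversion;
    f_equal; auto.
Qed.

Lemma fcode_inj a b : fcode a = fcode b -> a = b.
Proof.
  revert b. induction a; intros [] H; cbn -[to_nat] in H; to_nat_inversion;
    f_equal; auto using tcode_inj.
Qed.

Definition fdecode (n : nat) : form :=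
  epsilon (inhabits Bot) (fun a => fcode a = n).

Lemma fdecode_fcode a : fdecode (fcode a) = a.
Proof.
  apply fcode_inj. unfold fdecode. apply epsilon_spec. now exists a.
Qed.

Section Henkin.

Variable T : form -> Prop.
Hypothesis T_closed : subst_closed T.
Variable G0 : list form.
Hypothesis G0_consistent : ~ prv T G0 Bot.

Definition fresh (bound : form -> nat) (G : list form) : nat :=
  list_max (map bound G).

Lemma fresh_bound bound G a : In a G -> bound a <= fresh bound G.
Proof.
  intros H. pose proof (proj1 (list_max_le (map bound G) _) (le_n _)) as Hm.
  rewrite Forall_forall in Hm. apply Hm. now apply in_map.
Qed.

(** Henkin witnesses are fresh variables instead of new constants: every stage is a finite list, so
    the language need not be extended. Negated universal formulas suffice, since existential ones
    are encoded through them. *)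
Definition witness (G : list form) (a : form) : list form :=
  match a with
  | Imp (All1 b) Bot => [Neg (inst1 (Var (fresh bound1 (b :: a :: G))) b)]
  | Imp (All2 b) Bot => [Neg (inst2 (fresh bound2 (b :: a :: G)) b)]
  | _ => []
  end.

Definition extend (G : list form) (a : form) : list form :=
  if excluded_middle_informative (prv T (a :: G) Bot) then G
  else witness G a ++ a :: G.

Fixpoint stage (n : nat) : list form :=
  match n with
  | 0 => G0
  | S n => extend (stage n) (fdecode n)
  end.

(** If refuting the fresh instance were inconsistent, that instance would be provable; generalising
    over the fresh variable proves the universal formula, whose negation is [a]. *)
Lemma witness_consistent G a :
  ~ prv T (a :: G) Bot -> ~ prv T (witness G a ++ a :: G) Bot.
Proof.
  intros Ha H.
  destruct a as [| | | |[| | | | |b|b] []| |]; cbn in H; try contradiction;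
    apply Ha; (eapply prv_impE; [apply prv_hyp; now left|]);
    [eapply (prv_gen1 _ _ _ (fresh bound1 (b :: Imp (All1 b) Bot :: G)))
    |eapply (prv_gen2 _ _ _ (fresh bound2 (b :: Imp (All2 b) Bot :: G)))];
    auto using prv_raa, fresh_bound.
Qed.

Lemma stage_consistent n : ~ prv T (stage n) Bot.
Proof.
  induction n as [|n IH]; cbn; [exact G0_consistent|]. unfold extend.
  destruct excluded_middle_informative; auto using witness_consistent.
Qed.

Lemma stage_incl m n : m <= n -> incl (stage m) (stage n).
Proof.
  induction 1 as [|n _ IH]; [apply incl_refl|]. cbn. unfold extend.
  destruct excluded_middle_informative; [easy|].
  apply incl_appr, incl_tl, IH.
Qed.

Definition holds (a : form) : Prop := exists n, prv T (stage n) a.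

Lemma holds_prv G a : prv T G a -> (forall b, In b G -> holds b) -> holds a.
Proof.
  revert a. induction G as [|b G IH]; intros a H HG.
  - exists 0. now apply prv_weaken with (G := []).
  - destruct (IH (Imp b a)) as [m Hm].
    + now apply prv_impI.
    + intros c Hc. apply HG. now right.
    + destruct (HG b) as [n Hn]; [now left|].
      exists (max m n). apply prv_impE with b.
      * apply prv_weaken with (stage m); [easy|]. apply stage_incl. lia.
      * apply prv_weaken with (stage n); [easy|]. apply stage_incl. lia.
Qed.

Lemma holds_impE a b : holds (Imp a b) -> holds a -> holds b.
Proof.
  intros H1 H2. apply holds_prv with [Imp a b; a].
  - apply prv_impE with a; apply prv_hyp; cbn; auto.
  - cbn. now intros c [<-|[<-|[]]].
Qed.

Lemma holds_bot : ~ holds Bot.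
Proof. intros [n H]. now apply (stage_consistent n). Qed.

(** The formula [a] is treated at stage [fcode a]; if it is rejected there, its negation is already
    derivable. Both the completeness of the theory and its Henkin property come from this lemma. *)
Lemma holds_extend a :
  ~ holds (Neg a) -> exists G, forall b, In b (witness G a ++ [a]) -> holds b.
Proof.
  intros Ha. exists (stage (fcode a)). intros b Hb.
  exists (S (fcode a)). cbn. rewrite fdecode_fcode. unfold extend.
  destruct excluded_middle_informative as [H|_].
  - destruct Ha. exists (fcode a). now apply prv_impI.
  - apply prv_hyp. apply in_app_iff in Hb. apply in_app_iff. cbn in *. tauto.
Qed.

Lemma holds_neg a : ~ holds a -> holds (Neg a).
Proof.
  intros Ha. apply NNPP. intros H. apply holds_extend in H as [G HG].
  apply Ha, HG, in_app_iff. right. now left.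
Qed.

Lemma holds_raa a : ~ holds (Neg a) -> holds a.
Proof. intros H. apply NNPP. intros Ha. now apply H, holds_neg. Qed.

Lemma holds_imp a b : holds (Imp a b) <-> (holds a -> holds b).
Proof.
  split; [apply holds_impE|]. intros H.
  destruct (classic (holds a)) as [Ha|Ha].
  - apply holds_prv with [b]; [apply prv_impI, prv_hyp; cbn; auto|].
    cbn. intros c [<-|[]]. auto.
  - apply holds_prv with [Neg a].
    + apply prv_impI, prv_raa, prv_impE with a; apply prv_hyp; cbn; auto.
    + cbn. intros c [<-|[]]. now apply holds_neg.
Qed.

Lemma holds_not a : holds (Neg a) -> ~ holds a.
Proof. intros H Ha. apply holds_bot. eapply holds_impE; eauto. Qed.

Lemma holds_all1 a : holds (All1 a) <-> forall t, holds (inst1 t a).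
Proof.
  split.
  - intros [n H] t. exists n. now apply prv_all1E.
  - intros H. apply NNPP. intros Ha.
    destruct (holds_extend (Neg (All1 a))) as [G HG].
    + intros HN. apply Ha. apply holds_raa. now apply holds_not.
    (* The head of the list in [HG] is the negated instance at the witness variable, which
       contradicts [H]. *)
    + refine (holds_not _ (HG _ _) (H _)). now left.
Qed.

Lemma holds_all2 a : holds (All2 a) <-> forall X, holds (inst2 X a).
Proof.
  split.
  - intros [n H] X. exists n. now apply prv_all2E.
  - intros H. apply NNPP. intros Ha.
    destruct (holds_extend (Neg (All2 a))) as [G HG].
    + intros HN. apply Ha. apply holds_raa. now apply holds_not.
    + refine (holds_not _ (HG _ _) (H _)). now left.
Qed.

Lemma holds_eq_refl t : holds (Equal t t).
Proof. exists 0. apply prv_eq_refl. Qed.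

Lemma holds_eq_subst a s t :
  holds (Equal s t) -> holds (inst1 s a) -> holds (inst1 t a).
Proof.
  intros H1 H2. apply holds_prv with [Equal s t; inst1 s a].
  - apply prv_eq_subst with s; apply prv_hyp; cbn; auto.
  - cbn. now intros c [<-|[<-|[]]].
Qed.

Lemma tsubst_scons_tshift s t : tsubst (scons s Var) (tshift t) = t.
Proof. unfold tshift. rewrite tsubst_tsubst. apply tsubst_var. Qed.

Lemma holds_eq_term u s t :
  holds (Equal s t) ->
  holds (Equal (tsubst (scons s Var) u) (tsubst (scons t Var) u)).
Proof.
  intros H.
  pose proof (holds_eq_subst (Equal (tshift (tsubst (scons s Var) u)) u) s t H)
    as H'.
  cbn in H'. rewrite !tsubst_scons_tshift in H'. apply H', holds_eq_refl.
Qed.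

Lemma holds_eq_sym s t : holds (Equal s t) -> holds (Equal t s).
Proof.
  intros H. pose proof (holds_eq_subst (Equal (Var 0) (tshift s)) s t H) as H'.
  cbn in H'. rewrite !tsubst_scons_tshift in H'. apply H', holds_eq_refl.
Qed.

Lemma holds_eq_trans s t u :
  holds (Equal s t) -> holds (Equal t u) -> holds (Equal s u).
Proof.
  intros H1 H2. pose proof (holds_eq_subst (Equal (tshift s) (Var 0)) t u H2) as H'.
  cbn in H'. rewrite !tsubst_scons_tshift in H'. now apply H'.
Qed.

(** Two terms whose equality holds have the same representative, so that
    equality can be interpreted by Leibniz equality of representatives. *)
Definition repr (t : term) : term :=
  epsilon (inhabits Zero) (fun u => holds (Equal t u)).

Lemma repr_spec t : holds (Equal t (repr t)).
Proof. unfold repr. apply epsilon_spec. exists t. apply holds_eq_refl. Qed.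

Lemma repr_eq s t : repr s = repr t <-> holds (Equal s t).
Proof.
  split; intros H.
  - apply holds_eq_trans with (repr s); [apply repr_spec|].
    rewrite H. apply holds_eq_sym, repr_spec.
  - unfold repr. f_equal. apply functional_extensionality. intros u.
    apply propositional_extensionality.
    split; apply holds_eq_trans; [now apply holds_eq_sym | easy].
Qed.

Definition norm : Type := {t : term | repr t = t}.

Lemma repr_repr t : repr (repr t) = repr t.
Proof. apply repr_eq, holds_eq_sym, repr_spec. Qed.

Definition cls (t : term) : norm := exist _ (repr t) (repr_repr t).

Lemma cls_eq s t : cls s = cls t <-> holds (Equal s t).
Proof.
  rewrite <- repr_eq. split; intros H.
  - now injection H.
  - unfold cls. apply subset_eq_compat, H.
Qed.

Lemma cls_val (x : norm) : cls (proj1_sig x) = x.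
Proof. destruct x as [t Ht]. now apply subset_eq_compat. Qed.

Lemma holds_val t : holds (Equal (proj1_sig (cls t)) t).
Proof. cbn. apply holds_eq_sym, repr_spec. Qed.

(** Set variables serve as the sets without any quotient, since the language has no equality between
    sets. *)
Definition term_model : structure := {|
  num := norm;
  sets := nat;
  zero := cls Zero;
  one := cls One;
  plus x y := cls (Plus (proj1_sig x) (proj1_sig y));
  times x y := cls (Times (proj1_sig x) (proj1_sig y));
  lt x y := holds (Less (proj1_sig x) (proj1_sig y));
  elem x X := holds (Mem (proj1_sig x) X)
|}.

Lemma holds_congr_plus s s' t t' : holds (Equal s s') -> holds (Equal t t') ->
  holds (Equal (Plus s t) (Plus s' t')).
Proof.
  intros H1 H2. apply holds_eq_trans with (Plus s' t).
  - pose proof (holds_eq_term (Plus (Var 0) (tshift t)) s s' H1) as H.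
    cbn in H. now rewrite !tsubst_scons_tshift in H.
  - pose proof (holds_eq_term (Plus (tshift s') (Var 0)) t t' H2) as H.
    cbn in H. now rewrite !tsubst_scons_tshift in H.
Qed.

Lemma holds_congr_times s s' t t' : holds (Equal s s') -> holds (Equal t t') ->
  holds (Equal (Times s t) (Times s' t')).
Proof.
  intros H1 H2. apply holds_eq_trans with (Times s' t).
  - pose proof (holds_eq_term (Times (Var 0) (tshift t)) s s' H1) as H.
    cbn in H. now rewrite !tsubst_scons_tshift in H.
  - pose proof (holds_eq_term (Times (tshift s') (Var 0)) t t' H2) as H.
    cbn in H. now rewrite !tsubst_scons_tshift in H.
Qed.

Lemma holds_congr_less s s' t t' : holds (Equal s s') -> holds (Equal t t') ->
  holds (Less s t) -> holds (Less s' t').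
Proof.
  intros H1 H2 H.
  pose proof (holds_eq_subst (Less (Var 0) (tshift t)) s s' H1) as H3.
  pose proof (holds_eq_subst (Less (tshift s') (Var 0)) t t' H2) as H4.
  cbn in H3, H4. rewrite !tsubst_scons_tshift in H3, H4. auto.
Qed.

Lemma holds_congr_mem s s' X : holds (Equal s s') ->
  holds (Mem s X) -> holds (Mem s' X).
Proof. intros H1 H. exact (holds_eq_subst (Mem (Var 0) X) s s' H1 H). Qed.

Lemma eval_term_model s t :
  eval term_model (fun n => cls (s n)) t = cls (tsubst s t).
Proof.
  induction t; cbn [eval tsubst]; try easy;
    rewrite IHt1, IHt2; apply cls_eq;
    [apply holds_congr_plus | apply holds_congr_times]; apply holds_val.
Qed.

Lemma cls_scons t s :
  scons (cls t) (fun n => cls (s n)) = (fun n => cls (scons t s n)).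
Proof. apply functional_extensionality. now intros [|n]. Qed.

(** The truth lemma, for an arbitrary substitution so that the induction passes quantifiers: every
    number of the model is the class of a term, so an extended environment again comes from a
    substitution. *)
Lemma sat_term_model a : forall s r,
  sat term_model (fun n => cls (s n)) r a <-> holds (subst s r a).
Proof.
  induction a; intros s0 r; cbn [sat subst]; rewrite ?eval_term_model.
  - apply cls_eq.
  - split; apply holds_congr_less;
      first [apply holds_val | apply holds_eq_sym, holds_val].
  - split; apply holds_congr_mem;
      first [apply holds_val | apply holds_eq_sym, holds_val].
  - split; [easy | apply holds_bot].
  - now rewrite holds_imp, IHa1, IHa2.
  - rewrite holds_all1. split.
    + intros H t. specialize (H (cls t)). rewrite cls_scons, IHa in H.
      unfold inst1. rewrite subst_subst. erewrite subst_bound; [exact H| |easy].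
      intros [|n] _; cbn; [easy|apply tsubst_scons_tshift].
    + intros H x. rewrite <- (cls_val x), cls_scons, IHa.
      specialize (H (proj1_sig x)).
      unfold inst1 in H. rewrite subst_subst in H.
      erewrite subst_bound; [exact H| |easy].
      intros [|n] _; cbn; [easy|]. symmetry. apply tsubst_scons_tshift.
  - rewrite holds_all2. apply forall_iff. intros X. rewrite IHa.
    unfold inst2. rewrite subst_subst. cbn.
    erewrite subst_bound; [reflexivity| |].
    + intros n _. symmetry. apply tsubst_var.
    + now intros [|n] _.
Qed.

Lemma term_model_models : models term_model T.
Proof.
  intros a v V Ha.
  replace v with (fun n => cls (proj1_sig (v n))).
  - apply sat_term_model. exists 0.
    apply prv_weaken with []; [now apply T_closed | easy].
  - apply functional_extensionality. intros n. apply cls_val.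
Qed.

End Henkin.

Theorem completeness T a : subst_closed T ->
  (forall W v V, models W T -> sat W v V a) -> provable T a.
Proof.
  intros HT H. apply prv_raa, NNPP. intros HG.
  specialize (H (term_model T [Neg a]) (fun n => cls T [Neg a] (Var n)) (fun X => X)
                (term_model_models _ HT _ HG)).
  apply (sat_term_model T HT _ HG) in H. rewrite subst_var in H.
  apply (holds_not T HT _ HG a); [|easy]. exists 0. apply prv_hyp. now left.
Qed.

(** * The axioms of [RCA0] are closed under substitution *)

Lemma Delta00_subst a : Delta00 a -> forall s r, Delta00 (subst s r a).
Proof.
  induction 1; intros s0 r; cbn; [now constructor..| |].
  - fold (up1 s0). rewrite tsubst_up1_tshift. apply D_ball, IHDelta00.
  - fold (up1 s0). rewrite tsubst_up1_tshift. apply D_bex, IHDelta00.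
Qed.

Lemma subst_induction_axiom s r a :
  subst s r (induction_axiom a) = induction_axiom (subst (up1 s) r a).
Proof.
  unfold induction_axiom, And, Neg. cbn. rewrite subst_inst1.
  do 6 f_equal. rewrite !subst_subst. f_equal.
  apply functional_extensionality. intros [|n]; cbn; [easy|].
  unfold tshift. rewrite !tsubst_tsubst. easy.
Qed.

Lemma subst_comprehension_axiom s r a b :
  subst s r (comprehension_axiom a b)
  = comprehension_axiom (subst (up1 s) r a) (subst (up1 s) r b).
Proof.
  unfold comprehension_axiom. cbn. fold (up2 r).
  fold (up1 s). rewrite subst_shift2. reflexivity.
Qed.

(** For the eight basic axioms, whose free variables are among 0 and 1, this instance is convertible
    with the substitution by any [s] and [r]. It is obtained by closing the axiom and instantiating
    both quantifiers, the outer one with [s 1]. *)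
Lemma provable_two_variables T a s :
  T a -> provable T (subst (scons (s 0) (scons (s 1) Var)) (fun X => X) a).
Proof.
  intros Ha.
  assert (H : provable T (All1 (All1 a))) by (do 2 apply prv_all1I; now apply prv_ax).
  apply (prv_all1E _ _ _ (s 1)) in H. cbn in H.
  apply (prv_all1E _ _ _ (s 0)) in H. unfold inst1 in H.
  rewrite subst_subst in H.
  erewrite subst_bound; [exact H| |easy].
  intros [|[|n]] _; cbn; [easy| |easy].
  symmetry. apply tsubst_scons_tshift.
Qed.

Lemma RCA0_subst_closed : subst_closed RCA0.
Proof.
  intros a s r Ha. destruct Ha as [| | | | | | | |a Ha|a b Ha Hb].
  1-8: match goal with |- provable _ (subst ?s _ ?a) =>
         apply (provable_two_variables RCA0 a s); constructor end.
  - rewrite subst_induction_axiom. apply prv_ax, ax_Sigma01_induction.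
    destruct Ha as (b & Hb & ->).
    eexists. split; [|reflexivity]. now apply Delta00_subst.
  - rewrite subst_comprehension_axiom. apply prv_ax, ax_Delta01_comprehension.
    + destruct Ha as (c & Hc & ->).
      eexists. split; [|reflexivity]. now apply Delta00_subst.
    + destruct Hb as (c & Hc & ->).
      eexists. split; [|reflexivity]. now apply Delta00_subst.
Qed.

(** * Interval orders *)

(** (i3) and (i4) are merged into [F_antichain]. *)
Record proper_11 (A : Type) (P L : A -> Prop) (leP leL F : A -> A -> Prop) : Prop := {
  leL_trans x y z : leL x y -> leL y z -> leL x z;
  leL_antisym x y : leL x y -> leL y x -> x = y;
  leL_total x y : L x -> L y -> leL x y \/ leL y x;
  F_sub p x : F p x -> L x;
  F_convex p x y z : P p -> F p x -> F p y -> L z ->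
    leL x z /\ x <> z -> leL z y /\ z <> y -> F p z;
  F_order p q : P p -> P q ->
    (leP p q /\ p <> q <-> forall x y, F p x -> F q y -> leL x y /\ x <> y);
  F_antichain p q : P p -> P q -> (forall x, F p x -> F q x) -> p = q
}.

Section Interval_order.

Variables (A : Type) (P L : A -> Prop) (leP leL F : A -> A -> Prop).
Hypothesis HI : proper_11 A P L leP leL F.

Notation "p <P q" := (leP p q /\ p <> q) (at level 70).
Notation "x <L y" := (leL x y /\ x <> y) (at level 70).

Let leL_trans := leL_trans _ _ _ _ _ _ HI.
Let leL_antisym := leL_antisym _ _ _ _ _ _ HI.
Let leL_total := leL_total _ _ _ _ _ _ HI.
Let F_sub := F_sub _ _ _ _ _ _ HI.
Let F_convex := F_convex _ _ _ _ _ _ HI.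
Let F_order := F_order _ _ _ _ _ _ HI.
Let F_antichain := F_antichain _ _ _ _ _ _ HI.

Lemma ltL_trans x y z : x <L y -> y <L z -> x <L z.
Proof.
  intros [H1 N1] [H2 N2]. split; [eauto|]. intros <-. auto.
Qed.

Lemma ltL_irrefl x : ~ x <L x.
Proof. tauto. Qed.

Lemma ltL_total x y : L x -> L y -> ~ x <L y -> leL y x.
Proof.
  intros Hx Hy H. destruct (leL_total x y Hx Hy) as [H'|]; [|easy].
  destruct (classic (x = y)) as [->|]; tauto.
Qed.

Lemma leL_ltL_trans x y z : leL x y -> y <L z -> x <L z.
Proof.
  intros H1 [H2 N2]. split; [eauto|]. intros <-. auto.
Qed.

(** [F p] starts, equivalently ends, strictly to the left of [F q].  The
    witnesses outside the other set make this decidable by searching: for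
    distinct [p] and [q] such [x] and [y] exist, and any choice of them
    compares in the same way. *)
Definition before (p q : A) : Prop :=
  P p /\ P q /\
  exists x y, F p x /\ ~ F q x /\ F q y /\ ~ F p y /\ leL x y.

(** Were some z in F(q) not to the right of x, then z <= x <= y with z and y in F(q), and convexity
    would put x into F(q). *)
Lemma before_left p q : before p q ->
  exists x, F p x /\ forall z, F q z -> x <L z.
Proof.
  intros (Hp & Hq & x & y & px & qx & qy & py & xy). exists x. split; [easy|].
  intros z qz. apply NNPP. intros H. apply ltL_total in H; eauto.
  apply qx, F_convex with z y; eauto; split; congruence.
Qed.

Lemma before_right p q : before p q ->
  exists y, F q y /\ forall z, F p z -> z <L y.
Proof.
  intros (Hp & Hq & x & y & px & qx & qy & py & xy). exists y. split; [easy|].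
  intros z pz. apply NNPP. intros H. apply ltL_total in H; eauto.
  apply py, F_convex with x z; eauto; split; congruence.
Qed.

Lemma F_difference p q : P p -> P q -> p <> q -> exists x, F p x /\ ~ F q x.
Proof.
  intros Hp Hq N. apply NNPP. intros H. apply N, F_antichain; auto.
  intros x px. apply NNPP. eauto.
Qed.

(** One-sided information is enough: the missing witness in F(q) \ F(p) is supplied by the antichain
    property. *)
Lemma before_of_left p q x : P p -> P q ->
  F p x -> (forall z, F q z -> x <L z) -> before p q.
Proof.
  intros Hp Hq px Hx.
  assert (qx : ~ F q x) by (intros qx; now apply (ltL_irrefl x), Hx).
  destruct (F_difference q p) as (y & qy & py); auto; [congruence|].
  repeat split; auto. exists x, y. repeat split; auto. now apply Hx.
Qed.

Lemma before_of_right p q y : P p -> P q ->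
  F q y -> (forall z, F p z -> z <L y) -> before p q.
Proof.
  intros Hp Hq qy Hy.
  assert (py : ~ F p y) by (intros py; now apply (ltL_irrefl y), Hy).
  destruct (F_difference p q) as (x & px & qx); auto; [congruence|].
  repeat split; auto. exists x, y. repeat split; auto. now apply Hy.
Qed.

Lemma before_trans p q r : before p q -> before q r -> before p r.
Proof.
  intros Hpq Hqr.
  destruct (before_left _ _ Hpq) as (x & px & Hx).
  destruct (before_left _ _ Hqr) as (y & qy & Hy).
  apply before_of_left with x; [apply Hpq | apply Hqr | easy |].
  intros z rz. apply ltL_trans with y; auto.
Qed.

Lemma before_irrefl p : ~ before p p.
Proof. intros (_ & _ & x & y & H). tauto. Qed.

Lemma before_total p q : P p -> P q -> p <> q -> before p q \/ before q p.
Proof.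
  intros Hp Hq N.
  destruct (F_difference p q) as (x & px & qx); auto.
  destruct (F_difference q p) as (y & qy & py); auto.
  destruct (leL_total x y); eauto; [left|right]; repeat split; auto;
    [exists x, y | exists y, x]; auto.
Qed.

(** With [before_not_leL] this yields the Pi^0_1 description of [before]. Distinctness matters, as
    the condition on x and y is vacuous for equal elements. *)
Lemma before_alt p q : P p -> P q -> p <> q ->
  (forall x y, F p x -> ~ F q x -> F q y -> ~ F p y -> ~ leL y x) -> before p q.
Proof.
  intros Hp Hq N H.
  destruct (before_total p q) as [|(_ & _ & y & x & H')]; auto.
  destruct (H x y); tauto.
Qed.

Lemma before_not_leL p q x y : before p q ->
  F p x -> ~ F q x -> F q y -> ~ F p y -> ~ leL y x.
Proof.
  intros Hpq px qx qy py yx.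
  apply (before_irrefl p), before_trans with q; auto.
  destruct Hpq as (Hp & Hq & _). repeat split; auto. now exists y, x.
Qed.

(** The order on endpoints, [(p, false)] being the left endpoint of [p] and
    [(p, true)] the right one. *)
Definition le_endpoint (p : A) (i : bool) (q : A) (j : bool) : Prop :=
  match i, j with
  | true, false => p <P q
  | false, true => ~ q <P p
  | _, _ => p = q \/ before p q
  end.

Lemma not_ltP_meet p q : P p -> P q -> ~ p <P q ->
  exists x y, F p x /\ F q y /\ leL y x.
Proof.
  intros Hp Hq H. apply NNPP. intros N. apply H, F_order; auto.
  intros x y px qy. apply NNPP. intros N'. apply N.
  exists x, y. repeat split; auto. apply ltL_total; eauto.
Qed.

(** This lemma and the next three are the mixed cases of [le_endpoint_trans], some of them used
    there in contrapositive form. *)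
Lemma ltP_before_trans p q r : P p -> p <P q -> before q r -> p <P r.
Proof.
  intros Hp Hpq Hqr. destruct (before_left _ _ Hqr) as (y & qy & Hy).
  destruct Hqr as (Hq & Hr & _). apply F_order; auto. intros x z px rz.
  apply ltL_trans with y; auto. now apply (proj1 (F_order p q Hp Hq) Hpq).
Qed.

Lemma before_ltP_trans p q r : P r -> before p q -> q <P r -> p <P r.
Proof.
  intros Hr Hpq Hqr. destruct (before_right _ _ Hpq) as (y & qy & Hy).
  destruct Hpq as (Hp & Hq & _). apply F_order; auto. intros x z px rz.
  apply ltL_trans with y; auto. now apply (proj1 (F_order q r Hq Hr) Hqr).
Qed.

(** In terms of endpoints: the left end of p is at most the right end of q, which precedes the left
    end of r. A point x of F(p) below some point of F(q) is then left of all of F(r). *)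
Lemma not_ltP_ltP_before p q r : P p -> P q -> P r ->
  ~ q <P p -> q <P r -> before p r.
Proof.
  intros Hp Hq Hr Hqp Hqr. destruct (not_ltP_meet q p) as (y & x & qy & px & xy); auto.
  apply before_of_left with x; auto. intros z rz.
  apply leL_ltL_trans with y; auto. now apply (proj1 (F_order q r Hq Hr) Hqr).
Qed.

(** The mirror image: a point z of F(r) above some point of F(q) is right of all of F(p). *)
Lemma ltP_not_ltP_before p q r : P p -> P q -> P r ->
  p <P q -> ~ r <P q -> before p r.
Proof.
  intros Hp Hq Hr Hpq Hrq. destruct (not_ltP_meet r q) as (z & y & rz & qy & yz); auto.
  apply before_of_right with z; auto. intros x px.
  destruct (proj1 (F_order p q Hp Hq) Hpq x y px qy) as [xy N].
  split; [eauto|]. intros ->. eauto.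
Qed.

Lemma le_endpoint_refl p i : le_endpoint p i p i.
Proof. destruct i; now left. Qed.

Lemma le_endpoint_trans p i q j r k : P p -> P q -> P r ->
  le_endpoint p i q j -> le_endpoint q j r k -> le_endpoint p i r k.
Proof.
  intros Hp Hq Hr. destruct i, j, k; cbn.
  - intros [->|H] [->|H']; eauto using before_trans.
  - intros [->|H] H'; eauto using before_ltP_trans.
  - intros H H'. right. eauto using ltP_not_ltP_before.
  - intros H [->|H']; eauto using ltP_before_trans.
  - intros H [->|H'] N; eauto using before_ltP_trans.
  - intros H H'. right. eauto using not_ltP_ltP_before.
  - intros [->|H] H' N; eauto using ltP_before_trans.
  - intros [->|H] [->|H']; eauto using before_trans.
Qed.

Lemma le_endpoint_antisym p i q j :
  le_endpoint p i q j -> le_endpoint q j p i -> p = q /\ i = j.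
Proof.
  destruct i, j; cbn; try tauto;
    intros [->|H] [?|H']; auto;
    destruct (before_irrefl p); eauto using before_trans.
Qed.

Lemma le_endpoint_total p i q j : P p -> P q ->
  le_endpoint p i q j \/ le_endpoint q j p i.
Proof.
  intros Hp Hq. destruct (classic (p = q)) as [->|N].
  - destruct i, j; cbn; tauto.
  - destruct (before_total p q), i, j; cbn; tauto.
Qed.

Lemma le_endpoint_left_right p : le_endpoint p false p true.
Proof. cbn. tauto. Qed.

End Interval_order.

(** * Arithmetic in models of [RCA0] *)

Section Sat_connectives.

Variables (W : structure) (v : nat -> num W) (V : nat -> sets W).

Lemma sat_imp a b : sat W v V (Imp a b) <-> (sat W v V a -> sat W v V b).
Proof. easy. Qed.

Lemma sat_and a b : sat W v V (And a b) <-> sat W v V a /\ sat W v V b.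
Proof. cbn. destruct (classic (sat W v V b)); tauto. Qed.

Lemma sat_or a b : sat W v V (Or a b) <-> sat W v V a \/ sat W v V b.
Proof. cbn. destruct (classic (sat W v V a)); tauto. Qed.

Lemma sat_iff a b : sat W v V (Iff a b) <-> (sat W v V a <-> sat W v V b).
Proof. unfold Iff. now rewrite sat_and. Qed.

Lemma sat_all1 a : sat W v V (All1 a) <-> forall x, sat W (scons x v) V a.
Proof. easy. Qed.

Lemma sat_ex1 a : sat W v V (Ex1 a) <-> exists x, sat W (scons x v) V a.
Proof.
  cbn. split; [|firstorder]. intros H. apply NNPP. firstorder.
Qed.

Lemma sat_ex2 a : sat W v V (Ex2 a) <-> exists X, sat W v (scons X V) a.
Proof.
  cbn. split; [|firstorder]. intros H. apply NNPP. firstorder.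
Qed.

End Sat_connectives.

(** [reads v V a Q]: the satisfaction of [a], whose defined connectives are
    classical encodings, is expressed by [Q] with the connectives of Rocq. *)
Class reads {W : structure} (v : nat -> num W) (V : nat -> sets W) (a : form)
  (Q : Prop) : Prop := reads_iff : sat W v V a <-> Q.

Section Reads.

Context {W : structure} {v : nat -> num W} {V : nat -> sets W}.

#[export] Instance reads_equal s t :
  reads v V (Equal s t) (eval W v s = eval W v t).
Proof. red. easy. Qed.

#[export] Instance reads_less s t :
  reads v V (Less s t) (lt W (eval W v s) (eval W v t)).
Proof. red. easy. Qed.

#[export] Instance reads_mem t X : reads v V (Mem t X) (elem W (eval W v t) (V X)).
Proof. red. easy. Qed.

#[export] Instance reads_imp a b (Q R : Prop) :
  reads v V a Q -> reads v V b R -> reads v V (Imp a b) (Q -> R).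
Proof. unfold reads. cbn. tauto. Qed.

#[export] Instance reads_neg a (Q : Prop) : reads v V a Q -> reads v V (Neg a) (~ Q).
Proof. unfold reads. cbn. tauto. Qed.

#[export] Instance reads_and a b (Q R : Prop) :
  reads v V a Q -> reads v V b R -> reads v V (And a b) (Q /\ R).
Proof. unfold reads. rewrite sat_and. tauto. Qed.

#[export] Instance reads_or a b (Q R : Prop) :
  reads v V a Q -> reads v V b R -> reads v V (Or a b) (Q \/ R).
Proof. unfold reads. rewrite sat_or. tauto. Qed.

#[export] Instance reads_iff_form a b (Q R : Prop) :
  reads v V a Q -> reads v V b R -> reads v V (Iff a b) (Q <-> R).
Proof. unfold reads. rewrite sat_iff. tauto. Qed.

#[export] Instance reads_all1 a (Q : num W -> Prop) :
  (forall x, reads (scons x v) V a (Q x)) -> reads v V (All1 a) (forall x, Q x).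
Proof. unfold reads. cbn. firstorder. Qed.

#[export] Instance reads_all2 a (Q : sets W -> Prop) :
  (forall X, reads v (scons X V) a (Q X)) -> reads v V (All2 a) (forall X, Q X).
Proof. unfold reads. cbn. firstorder. Qed.

#[export] Instance reads_ex1 a (Q : num W -> Prop) :
  (forall x, reads (scons x v) V a (Q x)) -> reads v V (Ex1 a) (exists x, Q x).
Proof. unfold reads. rewrite sat_ex1. firstorder. Qed.

#[export] Instance reads_ex2 a (Q : sets W -> Prop) :
  (forall X, reads v (scons X V) a (Q X)) -> reads v V (Ex2 a) (exists X, Q X).
Proof. unfold reads. rewrite sat_ex2. firstorder. Qed.

End Reads.

(* Keeps instance search from unfolding the classical encodings and reading a defined connective as
   nested implications. *)
#[export] Typeclasses Opaque Neg And Or Iff Ex1 Ex2.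

Ltac read_in H := apply (proj1 reads_iff) in H; cbn [eval scons tshift tsubst] in H.
Ltac read := apply (proj2 reads_iff); cbn [eval scons tshift tsubst].

Section Model.

Variable W : structure.
Hypothesis W_models : models W RCA0.

Notation M := (num W).
Notation "0" := (zero W).
Notation "1" := (one W).
Notation "x + y" := (plus W x y).
Notation "x * y" := (times W x y).
Notation "x < y" := (lt W x y).

Implicit Types (v : nat -> num W) (V : nat -> sets W).

(** * Induction and comprehension inside a model *)

Lemma sigma01_induction b v V : Delta00 b ->
  (exists w, sat W (scons w (scons 0 v)) V b) ->
  (forall x, (exists w, sat W (scons w (scons x v)) V b) ->
     exists w, sat W (scons w (scons (x + 1) v)) V b) ->
  forall x, exists w, sat W (scons w (scons x v)) V b.
Proof.
  intros Hb H0 HS x.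
  pose proof (W_models _ v V (ax_Sigma01_induction (Ex1 b)
    (ex_intro _ b (conj Hb eq_refl)))) as H.
  unfold induction_axiom, inst1 in H.
  rewrite sat_imp, sat_and, !sat_all1, sat_subst in H.
  rewrite <- sat_ex1. apply H. clear H. split.
  - replace (fun n => eval W v (scons Zero Var n)) with (scons 0 v);
      [now apply sat_ex1|].
    apply functional_extensionality. now intros [|n].
  - intros y Hy. rewrite sat_ex1 in Hy. apply HS in Hy.
    apply sat_subst.
    replace (fun n => eval W (scons y v)
      (scons (Succ (Var 0)) (fun m => Var (S m)) n)) with (scons (y + 1) v);
      [now apply sat_ex1|].
    apply functional_extensionality. now intros [|n].
Qed.

(** A vacuous existential quantifier, made by [shift1], brings the formula into the shape of the
    Sigma^0_1 schema. *)
Lemma delta00_induction b v V : Delta00 b ->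
  sat W (scons 0 v) V b ->
  (forall x, sat W (scons x v) V b -> sat W (scons (x + 1) v) V b) ->
  forall x, sat W (scons x v) V b.
Proof.
  intros Hb H0 HS x.
  assert (E : forall w y, sat W (scons w (scons y v)) V (shift1 b)
                          <-> sat W (scons y v) V b).
  { intros w y. apply sat_subst. }
  assert (H : exists w, sat W (scons w (scons x v)) V (shift1 b)).
  { apply sigma01_induction.
    - now apply Delta00_subst.
    - exists 0. now apply E.
    - intros y [w Hw]. exists 0. apply E, HS. now apply E in Hw. }
  destruct H as [w Hw]. now apply E in Hw.
Qed.

Lemma delta01_comprehension b c v V : Delta00 b -> Delta00 c ->
  (forall n, (exists w, sat W (scons w (scons n v)) V b)
         <-> (forall w, sat W (scons w (scons n v)) V c)) ->
  exists X, forall n,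
    elem W n X <-> exists w, sat W (scons w (scons n v)) V b.
Proof.
  intros Hb Hc H.
  pose proof (W_models _ v V (ax_Delta01_comprehension (Ex1 b) (All1 c)
    (ex_intro _ b (conj Hb eq_refl)) (ex_intro _ c (conj Hc eq_refl)))) as HX.
  unfold comprehension_axiom, shift2 in HX.
  rewrite sat_imp, sat_ex2, sat_all1 in HX.
  destruct HX as [X HX].
  - intros n. rewrite sat_iff, sat_ex1. apply H.
  - exists X. intros n. rewrite sat_all1 in HX. specialize (HX n).
    rewrite sat_iff, sat_subst, sat_ex1 in HX. apply HX.
Qed.

(** The arithmetic axioms mention no sets, but [sat] needs a set assignment and the set sort is not
    assumed inhabited. *)
Variable V0 : nat -> sets W.

Let env1 x : nat -> M := scons x (fun _ => 0).
Let env2 x y : nat -> M := scons x (env1 y).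
Let env3 x y z : nat -> M := scons x (env2 y z).

(** * Semiring arithmetic and order in the model *)

Lemma succ_neq_0 x : x + 1 <> 0.
Proof. exact (W_models _ (env1 x) V0 ax_succ_neq0). Qed.

Lemma succ_inj x y : x + 1 = y + 1 -> x = y.
Proof. exact (W_models _ (env2 x y) V0 ax_succ_inj). Qed.

Lemma plus_0_r x : x + 0 = x.
Proof. exact (W_models _ (env1 x) V0 ax_plus0). Qed.

Lemma plus_succ_r x y : x + (y + 1) = x + y + 1.
Proof. exact (W_models _ (env2 x y) V0 ax_plusS). Qed.

Lemma times_0_r x : x * 0 = 0.
Proof. exact (W_models _ (env1 x) V0 ax_times0). Qed.

Lemma times_succ_r x y : x * (y + 1) = x * y + x.
Proof. exact (W_models _ (env2 x y) V0 ax_timesS). Qed.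

Lemma lt_succ_r x y : x < y + 1 <-> x < y \/ x = y.
Proof.
  pose proof (W_models _ (env2 x y) V0 ax_ltS) as H.
  rewrite sat_iff, sat_or in H. exact H.
Qed.

Lemma plus_assoc x y z : x + (y + z) = x + y + z.
Proof.
  refine (delta00_induction
    (Equal (Plus (Var 1) (Plus (Var 2) (Var 0))) (Plus (Plus (Var 1) (Var 2)) (Var 0)))
    (env2 x y) V0 (D_eq _ _) _ _ z); cbn.
  - now rewrite !plus_0_r.
  - intros w H. now rewrite !plus_succ_r, H.
Qed.

Lemma plus_0_l x : 0 + x = x.
Proof.
  refine (delta00_induction (Equal (Plus Zero (Var 0)) (Var 0))
    (fun _ => 0) V0 (D_eq _ _) _ _ x); cbn.
  - apply plus_0_r.
  - intros w H. now rewrite plus_succ_r, H.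
Qed.

Lemma plus_1_l x : 1 + x = x + 1.
Proof.
  refine (delta00_induction (Equal (Plus One (Var 0)) (Plus (Var 0) One))
    (fun _ => 0) V0 (D_eq _ _) _ _ x); cbn.
  - now rewrite plus_0_r, plus_0_l.
  - intros w H. now rewrite plus_succ_r, H.
Qed.

Lemma plus_comm x y : x + y = y + x.
Proof.
  refine (delta00_induction (Equal (Plus (Var 1) (Var 0)) (Plus (Var 0) (Var 1)))
    (env1 x) V0 (D_eq _ _) _ _ y); cbn.
  - now rewrite plus_0_r, plus_0_l.
  - intros w H. now rewrite plus_succ_r, H, <- !plus_assoc, plus_1_l.
Qed.

Lemma times_0_l x : 0 * x = 0.
Proof.
  refine (delta00_induction (Equal (Times Zero (Var 0)) Zero)
    (fun _ => 0) V0 (D_eq _ _) _ _ x); cbn.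
  - apply times_0_r.
  - intros w H. now rewrite times_succ_r, H, plus_0_r.
Qed.

Lemma times_plus_r x y z : x * (y + z) = x * y + x * z.
Proof.
  refine (delta00_induction
    (Equal (Times (Var 1) (Plus (Var 2) (Var 0)))
           (Plus (Times (Var 1) (Var 2)) (Times (Var 1) (Var 0))))
    (env2 x y) V0 (D_eq _ _) _ _ z); cbn.
  - now rewrite times_0_r, !plus_0_r.
  - intros w H. now rewrite plus_succ_r, !times_succ_r, H, plus_assoc.
Qed.

Lemma times_plus_l x y z : (x + y) * z = x * z + y * z.
Proof.
  refine (delta00_induction
    (Equal (Times (Plus (Var 1) (Var 2)) (Var 0))
           (Plus (Times (Var 1) (Var 0)) (Times (Var 2) (Var 0))))
    (env2 x y) V0 (D_eq _ _) _ _ z); cbn.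
  - now rewrite !times_0_r, plus_0_r.
  - intros w H. rewrite !times_succ_r, H, <- !plus_assoc. f_equal.
    now rewrite !plus_assoc, (plus_comm x).
Qed.

Lemma times_1_l x : 1 * x = x.
Proof.
  refine (delta00_induction (Equal (Times One (Var 0)) (Var 0))
    (fun _ => 0) V0 (D_eq _ _) _ _ x); cbn.
  - apply times_0_r.
  - intros w H. now rewrite times_succ_r, H.
Qed.

Lemma times_comm x y : x * y = y * x.
Proof.
  refine (delta00_induction (Equal (Times (Var 1) (Var 0)) (Times (Var 0) (Var 1)))
    (env1 x) V0 (D_eq _ _) _ _ y); cbn.
  - now rewrite times_0_r, times_0_l.
  - intros w H. now rewrite times_succ_r, H, times_plus_l, times_1_l.
Qed.

Lemma times_assoc x y z : x * (y * z) = x * y * z.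
Proof.
  refine (delta00_induction
    (Equal (Times (Var 1) (Times (Var 2) (Var 0)))
           (Times (Times (Var 1) (Var 2)) (Var 0)))
    (env2 x y) V0 (D_eq _ _) _ _ z); cbn.
  - now rewrite !times_0_r.
  - intros w H. now rewrite !times_succ_r, times_plus_r, H.
Qed.

Lemma num_semiring : semi_ring_theory 0 1 (plus W) (times W) eq.
Proof.
  split; auto using plus_0_l, plus_comm, plus_assoc, times_1_l, times_0_l,
    times_comm, times_assoc, times_plus_l.
Qed.

Add Ring num_ring : num_semiring.

Lemma plus_cancel_l z x y : z + x = z + y -> x = y.
Proof.
  rewrite !(plus_comm z).
  refine (delta00_induction
    (Imp (Equal (Plus (Var 1) (Var 0)) (Plus (Var 2) (Var 0)))
         (Equal (Var 1) (Var 2)))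
    (env2 x y) V0 _ _ _ z); cbn.
  - repeat constructor.
  - now rewrite !plus_0_r.
  - intros w H. rewrite !plus_succ_r. intros E. now apply H, succ_inj.
Qed.

(** The quantifier stands in front of the disjunction to fit Sigma^0_1 induction; in the zero case
    its witness is arbitrary. *)
Lemma zero_or_succ x : exists y, x = 0 \/ x = y + 1.
Proof.
  enough (H : exists y, sat W (env2 y x) V0
      (Or (Equal (Var 1) Zero) (Equal (Var 1) (Plus (Var 0) One))))
    by (destruct H as [y H]; rewrite sat_or in H; now exists y).
  apply sigma01_induction; [repeat constructor | |]; setoid_rewrite sat_or; cbn.
  - exists 0. now left.
  - intros y _. exists y. now right.
Qed.

Lemma plus_total x y : exists z, y = x + z \/ x = y + z.
Proof.
  enough (H : exists z, sat W (env3 z y x) V0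
      (Or (Equal (Var 1) (Plus (Var 2) (Var 0))) (Equal (Var 2) (Plus (Var 1) (Var 0)))))
    by (destruct H as [z H]; rewrite sat_or in H; now exists z).
  apply sigma01_induction; [repeat constructor | |]; setoid_rewrite sat_or; cbn.
  - exists x. right. ring.
  - intros w [z [->| ->]].
    + exists (z + 1). left. ring.
    + destruct (zero_or_succ z) as [u [->| ->]].
      * exists 1. left. ring.
      * exists u. right. ring.
Qed.

(** The source of all bounds on quantifiers below. *)
Lemma lt_plus x y : x < x + y + 1.
Proof.
  refine (delta00_induction
    (Less (Var 1) (Plus (Plus (Var 1) (Var 0)) One))
    (env1 x) V0 (D_lt _ _) _ _ y); cbn.
  - apply lt_succ_r. right. ring.
  - intros w H. apply lt_succ_r. left. now rewrite plus_succ_r.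
Qed.

(** * The pairing function *)

Definition pairing x y : M := (x + y) * (x + y) + x.

Lemma pair_bound_l x y : x < pairing x y + 1.
Proof.
  unfold pairing. rewrite (plus_comm _ x). apply lt_plus.
Qed.

(** Rests on s <= s * s for s = x + y, which is why s is split into zero and successor. *)
Lemma pair_bound_r x y : y < pairing x y + 1.
Proof.
  unfold pairing. destruct (zero_or_succ (x + y)) as [z [E|E]]; rewrite E.
  - destruct (zero_or_succ y) as [u [->| ->]].
    + replace (0 * 0 + x + 1) with (0 + x + 1) by ring. apply lt_plus.
    + destruct (succ_neq_0 (x + u)). rewrite <- E. ring.
  - replace ((z + 1) * (z + 1) + x + 1) with (z + 1 + (z * z + z + x) + 1) by ring.
    rewrite <- E. replace (x + y + (z * z + z + x) + 1)
      with (y + (x + z * z + z + x) + 1) by ring.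
    apply lt_plus.
Qed.

Lemma plus_succ_neq x y : x <> x + (y + 1).
Proof.
  intros E. apply (succ_neq_0 y), (plus_cancel_l x). now rewrite <- E, plus_0_r.
Qed.

(** A larger sum cannot give the same code: with s = x + y, the next square already exceeds s * s +
    x. *)
Lemma pair_inj_le x y x' y' z :
  x' + y' = x + y + z -> pairing x y = pairing x' y' -> x = x' /\ y = y'.
Proof.
  intros Hz E. unfold pairing in E. rewrite Hz in E.
  destruct (zero_or_succ z) as [u [->| ->]].
  - rewrite plus_0_r in E. apply plus_cancel_l in E. subst x'. split; [easy|].
    apply (plus_cancel_l x). rewrite Hz. ring.
  (* With s = x + y and x' + y' = s + u + 1, this number plus one is what remains of (s + u + 1) *
     (s + u + 1) + x' after taking away s * s and x. *)
  - destruct (plus_succ_neq x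
      (x + y + y + (x + y) * u + (x + y) * u + u * u + u + u + x')).
    apply (plus_cancel_l ((x + y) * (x + y))). rewrite E. ring.
Qed.

Lemma pair_inj x y x' y' : pairing x y = pairing x' y' -> x = x' /\ y = y'.
Proof.
  intros E. destruct (plus_total (x + y) (x' + y')) as [z [Hz|Hz]].
  - now apply pair_inj_le with z.
  - apply eq_sym, (pair_inj_le _ _ _ _ z) in E as [-> ->]; easy.
Qed.

(** * Comprehension for binary relations *)

Definition pcode (s t : term) : term := Plus (Times (Plus s t) (Plus s t)) s.

(** The formula holds when [Var 1] is the code of a pair [(p, q)] such that [b]
    holds with [p] and [q] pushed on the environment, [q] last. *)
Definition on_pairs (b : form) : form :=
  Ex1 (And (Less (Var 0) (tshift (Succ (Var 1))))
    (Ex1 (And (Less (Var 0) (tshift (Succ (Var 2))))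
       (And (Equal (Var 3) (pcode (Var 1) (Var 0))) b)))).

Lemma sat_on_pairs b v V : sat W v V (on_pairs b)
  <-> exists p q, v 1%nat = pairing p q /\ sat W (scons q (scons p v)) V b.
Proof.
  unfold on_pairs.
  rewrite sat_ex1. setoid_rewrite sat_and. setoid_rewrite sat_ex1.
  do 2 setoid_rewrite sat_and. cbn. split.
  - intros (p & _ & q & _ & H). now exists p, q.
  - intros (p & q & E & H). rewrite E. exists p. split; [apply pair_bound_l|].
    exists q. split; [apply pair_bound_r|]. now split.
Qed.

Lemma Delta00_on_pairs b : Delta00 b -> Delta00 (on_pairs b).
Proof.
  intros Hb. apply D_bex, D_bex. repeat constructor. easy.
Qed.

(** The unbounded variable w stays outside the bounded search for p and q, as the schema demands; in
    [b] and [c] the variables 0, 1, 2 are q, p, w. *)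
Lemma delta01_relation b c V (Q : M -> M -> Prop) :
  Delta00 b -> Delta00 c ->
  (forall v p q, (exists w, sat W (scons q (scons p (scons w v))) V b) <-> Q p q) ->
  (forall v p q, (forall w, sat W (scons q (scons p (scons w v))) V c) <-> Q p q) ->
  exists X, forall n, elem W n X <-> exists p q, n = pairing p q /\ Q p q.
Proof.
  intros Hb Hc Eb Ec.
  destruct (delta01_comprehension (on_pairs b) (on_pairs c) (fun _ => 0) V)
    as [X HX]; auto using Delta00_on_pairs.
  - intros n. setoid_rewrite sat_on_pairs. cbn. split.
    + intros (w & p & q & E & H) w'. exists p, q. split; [easy|].
      apply Ec. apply (Eb (scons n (fun _ => 0))). now exists w.
    + intros H. destruct (H 0) as (p & q & E & _).
      destruct (proj2 (Eb (scons n (fun _ => 0)) p q)) as [w Hw];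
        [|now exists w, p, q].
      apply (Ec (scons n (fun _ => 0))). intros w.
      (* The decoded pair could depend on w; injectivity of the pairing makes it the same for all
         w. *)
      destruct (H w) as (p' & q' & E' & Hw).
      rewrite E in E'. now apply pair_inj in E' as [-> ->].
  - exists X. intros n. rewrite HX. setoid_rewrite sat_on_pairs. cbn. split.
    + intros (w & p & q & E & H). exists p, q. split; [exact E|].
      apply (Eb (scons n (fun _ => 0))). now exists w.
    + intros (p & q & E & H). apply (Eb (scons n (fun _ => 0))) in H as [w Hw].
      now exists w, p, q.
Qed.

Lemma delta00_relation b V (Q : M -> M -> Prop) :
  Delta00 b -> (forall v p q, sat W (scons q (scons p v)) V b <-> Q p q) ->
  exists X, forall n, elem W n X <-> exists p q, n = pairing p q /\ Q p q.
Proof.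
  intros Hb E. apply (delta01_relation b b V); auto.
  - intros v p q. setoid_rewrite E. split; [now intros [_ H] | now exists 0].
  - intros v p q. setoid_rewrite E. split; [intros H; exact (H 0) | easy].
Qed.

Lemma pair_elem R (Q : M -> M -> Prop) :
  (forall n, elem W n R <-> exists x y, n = pairing x y /\ Q x y) ->
  forall x y, elem W (pairing x y) R <-> Q x y.
Proof.
  intros H x y. rewrite H. split; [|now exists x, y].
  intros (x' & y' & E & Hxy). now apply pair_inj in E as [-> ->].
Qed.

Ltac delta00 := repeat first [apply D_ball | apply D_bex | constructor].

(** * The endpoint order as a set of the model *)

Section Representation.

Variables P leP L leL F : sets W.

Notation in_set X := (fun x => elem W x X).
Notation rel R := (fun x y => elem W (pairing x y) R).

Hypothesis HI : proper_11 M (in_set P) (in_set L) (rel leP) (rel leL) (rel F).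

Notation before := (before M (in_set P) (rel leL) (rel F)).
Notation le_endpoint := (le_endpoint M (in_set P) (rel leP) (rel leL) (rel F)).

Let V1 : nat -> sets W := scons P (scons leP (scons leL (scons F V0))).

(** In the environment [y, x, q, p]. *)
Definition separated_form : form :=
  And (Mem (pcode (Var 3) (Var 1)) 3) (And (Neg (Mem (pcode (Var 2) (Var 1)) 3))
    (And (Mem (pcode (Var 2) (Var 0)) 3) (Neg (Mem (pcode (Var 3) (Var 0)) 3)))).

(** Both descriptions need a single unbounded quantifier over numbers, so one number w bounds x and
    y together; w = x + y + 1 is large enough for a given pair. *)
Lemma before_comprehension : exists T, forall n, elem W n T <->
  exists p q, n = pairing p q /\ before p q.
Proof.
  apply (delta01_relation
    (And (Mem (Var 1) 0) (And (Mem (Var 0) 0)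
      (Ex1 (And (Less (Var 0) (tshift (Var 2)))
        (Ex1 (And (Less (Var 0) (tshift (Var 3)))
          (And separated_form (Mem (pcode (Var 1) (Var 0)) 2))))))))
    (And (Mem (Var 1) 0) (And (Mem (Var 0) 0) (And (Neg (Equal (Var 1) (Var 0)))
      (All1 (Imp (Less (Var 0) (tshift (Var 2)))
        (All1 (Imp (Less (Var 0) (tshift (Var 3)))
          (Imp separated_form (Neg (Mem (pcode (Var 0) (Var 1)) 2))))))))))
    V1); [delta00 | delta00 | |]; unfold separated_form; intros v p q; split.
  - intros [w H]. read_in H. cbn in H. fold pairing in H.
    destruct H as (Hp & Hq & x & _ & y & _ & H). repeat split; auto.
    exists x, y. tauto.
  - intros (Hp & Hq & x & y & H). exists (x + y + 1). read.
    repeat split; auto. exists x. split; [apply lt_plus|].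
    exists y. split; [rewrite (plus_comm x); apply lt_plus|]. cbn. tauto.
  (* The conjuncts extracted here do not depend on w, so any value, such as 0, will do. *)
  - intros H. assert (H' := H 0). read_in H'. destruct H' as (Hp & Hq & N & _).
    eapply before_alt; [exact HI | easy..|]. intros x y px qx qy py.
    specialize (H (x + y + 1)). read_in H. destruct H as (_ & _ & _ & H).
    intros yx. apply (H x) with y; [apply lt_plus | | now repeat split | exact yx].
    rewrite (plus_comm x). apply lt_plus.
  - intros H w. read.
    split; [apply H|]. split; [apply H|]. split.
    + intros E. cbn in E. rewrite E in H. now apply before_irrefl in H.
    + intros x _ y _ (px & qx & qy & py).
      now apply (before_not_leL _ _ _ _ _ _ HI p q x y).
Qed.

Definition endpoint (p : M) (i : bool) : M := pairing p (if i then 1 else 0).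

Lemma endpoint_inj p i q j : endpoint p i = endpoint q j -> p = q /\ i = j.
Proof.
  intros E. apply pair_inj in E as [-> E]. split; [easy|].
  rewrite <- (plus_0_l 1) in E.
  destruct i, j; auto; [|symmetry in E]; now apply succ_neq_0 in E.
Qed.

Definition le_endpoint_code (a b : M) : Prop :=
  exists p i q j, a = endpoint p i /\ b = endpoint q j /\
    elem W p P /\ elem W q P /\
    le_endpoint p i q j.

(** Once [before] is a set T, it can be used as a parameter and the endpoint order becomes
    Delta^0_0: p and q are bounded by the codes a and b of their endpoints. *)
Lemma le_endpoint_comprehension : exists R, forall n, elem W n R <->
  exists a b, n = pairing a b /\ le_endpoint_code a b.
Proof.
  destruct before_comprehension as [T HT].
  pose proof (pair_elem _ _ HT) as HT'.
  pose (ends (s t : term) (b : form) :=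
    And (Equal (Var 3) (pcode (Var 1) s)) (And (Equal (Var 2) (pcode (Var 0) t)) b)).
  pose (same := Or (Equal (Var 1) (Var 0)) (Mem (pcode (Var 1) (Var 0)) 0)).
  apply (delta00_relation
    (Ex1 (And (Less (Var 0) (tshift (Succ (Var 1))))
      (Ex1 (And (Less (Var 0) (tshift (Succ (Var 1))))
        (And (Mem (Var 1) 1) (And (Mem (Var 0) 1)
          (Or (Or (ends Zero Zero same) (ends One One same))
            (Or (ends One Zero (And (Mem (pcode (Var 1) (Var 0)) 2)
                                  (Neg (Equal (Var 1) (Var 0)))))
                (ends Zero One (Neg (And (Mem (pcode (Var 0) (Var 1)) 2)
                                  (Neg (Equal (Var 0) (Var 1)))))))))))))) (scons T V1)).
  { unfold ends, same. delta00. }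
  unfold ends, same. intros v a b. split.
  - intros H. read_in H.
    destruct H as (p & _ & q & _ & Hp & Hq & [[H|H]|[H|H]]);
      destruct H as (Ea & Eb & H);
      [exists p, false, q, false | exists p, true, q, true
      |exists p, true, q, false | exists p, false, q, true];
      do 4 (split; [easy|]).
    + cbn. rewrite <- HT'. exact H.
    + cbn. rewrite <- HT'. exact H.
    + exact H.
    + exact H.
  - intros (p & i & q & j & -> & -> & Hp & Hq & H). read.
    exists p. split; [apply pair_bound_l|]. exists q. split; [apply pair_bound_l|].
    split; [easy|]. split; [easy|].
    destruct i, j; cbn in H; try rewrite <- HT' in H.
    + left; right. auto.
    + right; left. auto.
    + right; right. auto.
    + left; left. auto.
Qed.

Lemma endpoint_comprehension : exists L', forall n, elem W n L' <->
  exists p i, elem W p P /\ n = endpoint p i.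
Proof.
  destruct (delta00_relation
    (And (Mem (Var 1) 0) (Or (Equal (Var 0) Zero) (Equal (Var 0) One))) V1
    (fun p x => elem W p P /\ (x = 0 \/ x = 1))) as [L' HL'].
  - delta00.
  - intros v p x. apply reads_iff.
  - exists L'. intros n. rewrite HL'. split.
    + intros (p & x & -> & Hp & [->| ->]); [now exists p, false | now exists p, true].
    + intros (p & i & Hp & ->). exists p, (if i then 1 else 0). split; [easy|].
      destruct i; auto.
Qed.

Lemma endpoint_function i : exists f, forall n, elem W n f <->
  exists p x, n = pairing p x /\ (elem W p P /\ x = endpoint p i).
Proof.
  apply (delta00_relation
    (And (Mem (Var 1) 0)
       (Equal (Var 0) (pcode (Var 1) (if i then One else Zero)))) V1).
  - delta00.
  - intros v p x. destruct i; apply reads_iff.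
Qed.

Lemma le_endpoint_code_spec p i q j : elem W p P -> elem W q P ->
  le_endpoint_code (endpoint p i) (endpoint q j) <-> le_endpoint p i q j.
Proof.
  intros Hp Hq. split.
  - intros (p' & i' & q' & j' & Ep & Eq & _ & _ & H).
    apply endpoint_inj in Ep as [-> ->]. now apply endpoint_inj in Eq as [-> ->].
  - intros H. now exists p, i, q, j.
Qed.

Lemma lt_endpoint_code p i q j : elem W p P -> elem W q P ->
  le_endpoint_code (endpoint p i) (endpoint q j) /\ endpoint p i <> endpoint q j
  <-> le_endpoint p i q j /\ ~ (p = q /\ i = j).
Proof.
  intros Hp Hq. rewrite le_endpoint_code_spec by easy.
  split; intros [H N]; (split; [easy|]).
  - intros [-> ->]. now apply N.
  - intros E. now apply N, endpoint_inj.
Qed.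

End Representation.

End Model.

(** * The closed interval representation *)

Theorem theorem6p16 :
  provable RCA0
    (sentence
       (∀² P leP,
          proper_11_interval_order P leP ⇒ proper_closed_interval_order P leP)%l2).
Proof.
  apply completeness; [exact RCA0_subst_closed|]. intros W v V HW.
  unfold sentence, proper_11_interval_order, proper_closed_interval_order,
    linear_order, partial_order, cond_i1, cond_i2, cond_i3, cond_i4, cond_c1,
    cond_c2, cond_c5, is_function, subset_prod, section_sub, section_eq, srel,
    rel, mem, code, fconj, disj, impl, neg, equi, teq, all1, ex1, all2, ex2.
  (* Evaluating the subtractions turns the named variables into concrete de Bruijn indices, on which
     [read] can work. *)
  cbn [Nat.sub]. read.
  intros P leP [HP (L & leL & F & (HL & L_total) & F_prod & Hi1 & Hi2 & Hi3 & Hi4)].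
  split; [exact HP|].
  destruct HL as (_ & _ & L_trans & L_antisym).
  assert (HI : proper_11 (num W) (fun x => elem W x P) (fun x => elem W x L)
    (fun x y => elem W (pairing W x y) leP) (fun x y => elem W (pairing W x y) leL)
    (fun x y => elem W (pairing W x y) F)).
  { split.
    - intros x y z H H'. now apply (L_trans x y z).
    - intros x y H H'. now apply L_antisym.
    - intros x y Hx Hy. now apply L_total.
    - intros p x H. destruct (F_prod _ H) as (p' & x' & _ & Hx & E).
      now apply (pair_inj W HW V) in E as [_ ->].
    - intros p x y z Hp px py Hz Hxz Hzy.
      now apply (proj2 (Hi1 p Hp) x y z).
    - intros p q Hp Hq. rewrite (Hi2 p q (conj Hp Hq)).
      split; [intros H x y px qy; now apply H | intros H x y [px qy]; now apply H].
    - intros p q Hp Hq H. apply NNPP. intros N.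
      apply (Hi3 p q (conj Hp Hq) N). now apply Hi4. }
  destruct (endpoint_comprehension W HW V P leP leL F) as [L' HL'].
  destruct (le_endpoint_comprehension W HW V P leP L leL F HI) as [R HR].
  destruct (endpoint_function W HW V P leP leL F false) as [f0 Hf0].
  destruct (endpoint_function W HW V P leP leL F true) as [f1 Hf1].
  pose proof (pair_elem W HW V _ _ HR) as HR'.
  pose proof (pair_elem W HW V _ _ Hf0) as Hf0'.
  pose proof (pair_elem W HW V _ _ Hf1) as Hf1'.
  pose proof (le_endpoint_code_spec W HW V P leP leL F) as le_spec.
  pose proof (lt_endpoint_code W HW V P leP leL F) as lt_spec.
  assert (endpoint_L' : forall p i, elem W p P -> elem W (endpoint W p i) L').
  { intros p i Hp. apply HL'. now exists p, i. }
  assert (function_sub : forall f i, (forall n, elem W n f <->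
      exists p x, n = pairing W p x /\ (elem W p P /\ x = endpoint W p i)) ->
    forall n, elem W n f -> exists p x, elem W p P /\ elem W x L' /\ n = pairing W p x).
  { intros f i Hf n Hn. apply Hf in Hn as (p & x & -> & Hp & ->).
    exists p, (endpoint W p i). auto. }
  (* The goal contains codes of pairs as explicit sums and products, so [pairing] is unfolded to let
     the rewrites match. *)
  exists L', R, f0, f1. unfold pairing in HR', Hf0', Hf1'.
  repeat setoid_rewrite HR'. repeat setoid_rewrite Hf0'. repeat setoid_rewrite Hf1'.
  split; [|split; [|split; [|split; [|split]]]].
  - split; [split; [|split; [|split]]|].
    + intros n Hn. apply HR in Hn as (a & b & -> & p & i & q & j & -> & -> & Hp & Hq & _).
      exists (endpoint W p i), (endpoint W q j). auto.
    + intros a Ha. apply HL' in Ha as (p & i & Hp & ->).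
      apply le_spec; auto. apply le_endpoint_refl.
    + intros a b c [(p & i & q & j & -> & -> & Hp & Hq & Hpq) H].
      destruct H as (q' & j' & r & k & E & -> & _ & Hr & Hqr).
      (* The two hypotheses decode the middle endpoint separately; injectivity identifies the
         results. *)
      apply (endpoint_inj W HW V) in E as [<- <-]. apply le_spec; auto.
      now apply (le_endpoint_trans _ _ _ _ _ _ HI p i q j r k).
    + intros a b [(p & i & q & j & -> & -> & Hp & Hq & Hpq) H].
      apply le_spec in H; auto.
      now destruct (le_endpoint_antisym _ _ _ _ _ _ HI p i q j) as [-> ->].
    + intros a b [Ha Hb]. apply HL' in Ha as (p & i & Hp & ->).
      apply HL' in Hb as (q & j & Hq & ->). rewrite !le_spec; auto.
      now apply (le_endpoint_total _ _ _ _ _ _ HI).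
  - split; [now apply (function_sub f0 false)|]. split; [eauto|].
    now intros p x y [[_ ->] [_ ->]].
  - split; [now apply (function_sub f1 true)|]. split; [eauto|].
    now intros p x y [[_ ->] [_ ->]].
  - intros p x y (Hp & [_ ->] & [_ ->]). apply le_spec; auto.
    apply le_endpoint_left_right.
  (* For (c2), a right endpoint lies below a left one exactly when p <_P q, and endpoints of
     different kinds are never equal. *)
  - intros p q x y (Hp & Hq & [_ ->] & [_ ->]). rewrite lt_spec; auto. cbn.
    intuition discriminate.
  (* For (c5), both sides reduce to the same comparison of p with q by [before]. *)
  - intros p q x0 y0 x1 y1 (Hp & Hq & [_ ->] & [_ ->] & [_ ->] & [_ ->]).
    rewrite !lt_spec; auto. cbn. intuition.
Qed.
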